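(* Let $n\ge2$ and let $p_c^\circ<1$ be the critical parameter for oriented site percolation on $\mathbb{Z}^2$. For any $\theta\in[0,1]$ with $\theta>p_c^\circ$, there is Rough Mount Fuji accessibility percolation with positive probability on $\mathbb{Z}^n$ with the $\ell^1$ (graph) distance. Thus $\theta_c'\le p_c^\circ$. This holds in the case where only non-backtracking paths are permitted, and therefore also when all simple paths are permitted.
   Context: Consider $\mathbb{Z}^n$ with nearest-neighbour edges and root $0$. Rough Mount Fuji (RMF) labels with the $\ell^1$ distance: for $\theta\in[0,1]$, let $\{U_v:v\in\mathbb{Z}^n\}$ be i.i.d. Uniform$(0,1)$ and set $X_v=U_v+\theta\|v\|_1$. A simple path $x_0=0,x_1,x_2,\ldots$ is increasing if $X_{x_0}<X_{x_1}<\cdots$; it is non-backtracking if $\|x_{j+1}\|_1>\|x_j\|_1$ for each $j$. RMF accessibility percolation is the event that there is an infinite increasing permitted path from $0$, and $\theta_c'=\sup\{\theta\in[0,1]:\mathbb{P}_\theta(\text{RMF accessibility percolation})=0\}$. Oriented site percolation on $\mathbb{Z}^2$: on $\mathbb{Z}_+^2$ with directed edges from $(x,y)$ to $(x+1,y)$ and to $(x,y+1)$, each site is open independently with probability $p\in[0,1]$. The critical value $p_c^\circ$ is such that for $p>p_c^\circ$ there is positive probability of an infinite directed path of open sites starting from $0$, whereas for $p<p_c^\circ$ almost surely no such infinite path exists; it is known that $p_c^\circ<1$ (indeed $p_c^\circ\le0.72599$). *)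

(* Defs.v *)
From HB Require Import structures.
From mathcomp Require Export all_boot all_order all_algebra finmap.
From mathcomp Require Export all_classical all_reals all_analysis.

Set Implicit Arguments.
Unset Strict Implicit.
Unset Printing Implicit Defensive.

Import Order.TTheory GRing.Theory Num.Theory.

Local Open Scope classical_set_scope.
Local Open Scope ring_scope.

Section Independence.
Context (d d' : measure_display) (T : measurableType d) (T' : measurableType d').
Context (R : realType) (P : probability T R) (I : choiceType).

Definition mutually_independent (X : I -> {RV P >-> T'}) : Prop :=
  forall (J : {fset I}) (B : I -> set T'), (forall i, measurable (B i)) ->
    P (\bigcap_(i in [set` J]) (X i @^-1` B i)) =
    (\prod_(i <- J) P (X i @^-1` B i))%E.

End Independence.

Section Lattice.
Context (n : nat).
Implicit Types (v w : 'rV[int]_n) (x : nat -> 'rV[int]_n).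

Definition l1norm v : nat := (\sum_(i < n) `|v ord0 i|)%N.

Definition lattice_adj v w : Prop := l1norm (w - v) = 1%N.

Definition simple_path x : Prop :=
  (forall j, lattice_adj (x j) (x j.+1)) /\ injective x.

Definition non_backtracking_path x : Prop :=
  simple_path x /\ forall j, (l1norm (x j) < l1norm (x j.+1))%N.

End Lattice.

Section RoughMountFuji.
Context (d : measure_display) (T : measurableType d) (R : realType).
Context (P : probability T R) (n : nat).
Implicit Types (U : 'rV[int]_n -> {RV P >-> R}) (theta : R).
Implicit Types (permitted : (nat -> 'rV[int]_n) -> Prop).

Definition iid_uniform01 U : Prop :=
  mutually_independent U /\
  forall v (A : set R), measurable A ->
    distribution P (U v) A = uniform_prob (ltr01 : (0 : R) < 1) A.

Definition rmf_label U theta (v : 'rV[int]_n) (w : T) : R :=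
  U v w + theta * (l1norm v)%:R.

(* The event is measurable when [permitted] is one of [simple_path],
   [non_backtracking_path]: the graph is locally finite, so by Koenig's lemma
   it is the decreasing intersection of the events that there is a permitted
   increasing path with k steps. *)
Definition rmf_percolation permitted U theta : set T :=
  [set w | exists x : nat -> 'rV[int]_n,
     [/\ x 0%N = 0, permitted x &
         forall j, rmf_label U theta (x j) w < rmf_label U theta (x j.+1) w]].

(* The set contains theta = 0, so [sup] does not fall back on its default. *)
Definition rmf_critical permitted U : R :=
  sup [set theta | 0 <= theta <= 1 /\
                   P (rmf_percolation permitted U theta) = 0%E].

End RoughMountFuji.

Section OrientedSitePercolation.
Context (d : measure_display) (T : measurableType d) (R : realType).
Context (P : probability T R).
Implicit Types (sigma : nat * nat -> {RV P >-> bool}).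

Definition oriented_edge (a b : nat * nat) : Prop :=
  b = (a.1.+1, a.2) \/ b = (a.1, a.2.+1).

Definition iid_open_sites sigma (p : R) : Prop :=
  mutually_independent sigma /\
  forall a, P (sigma a @^-1` [set true]) = p%:E.

Definition oriented_percolation sigma : set T :=
  [set w | exists x : nat -> nat * nat,
     [/\ x 0%N = (0%N, 0%N), forall j, oriented_edge (x j) (x j.+1) &
         forall j, sigma (x j) w = true]].

End OrientedSitePercolation.

(* The probability of [oriented_percolation sigma] depends only on the joint
   law of [sigma], that is on p; the law is represented by all the probability
   spaces that carry a field of independent sites open with probability p.
   At most one pc satisfies the predicate. *)
Definition is_oriented_critical (R : realType) (pc : R) : Prop :=
  0 <= pc <= 1 /\
  forall p : R, 0 <= p <= 1 ->
  forall (d : measure_display) (T : measurableType d) (P : probability T R)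
    (sigma : nat * nat -> {RV P >-> bool}), iid_open_sites sigma p ->
    (pc < p -> (0 < P (oriented_percolation sigma))%E) /\
    (p < pc -> {ae P, forall w, ~ oriented_percolation sigma w}).

(* Main.v *)
From HB Require Import structures.
Require Import Defs.
From mathcomp Require Import measurable_realfun zify lra.

Set Implicit Arguments.
Unset Strict Implicit.
Unset Printing Implicit Defensive.

Import Order.TTheory GRing.Theory Num.Theory.
Local Open Scope classical_set_scope.
Local Open Scope ring_scope.

(** The labels along an outward step from [v] to [w] increase as soon as
    [U v < theta] and [U w >= 0], because the drift contributes [theta] to
    [X w - X v].  Call a site [v] low when [0 <= U v < theta]: a path of
    low sites that moves away from the origin at each step is increasing.
    The sites of a coordinate quadrant [{(a, b, 0, ..., 0) | a, b >= 0}] are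
    low independently with probability [theta] ([iid_low_sites]), and directed
    paths in that quadrant move outwards, so oriented percolation of its low
    sites implies accessibility percolation along a non-backtracking path
    ([oriented_sub_rmf]).  For [theta > pc] the former event has positive
    probability, by definition of the critical value; simple paths are then
    covered by inclusion of events, and the bound on the critical parameter
    follows.

    Comparing the probabilities of these events needs their measurability,
    although each of them is an uncountable union over infinite paths.  It
    comes from local finiteness: by Koenig's lemma ([koenig_path]) an infinite
    path exists as soon as arbitrarily long finite ones do, and the existence
    of a path of given length is a countable union of measurable conditions
    ([measurable_infinite_path]). *)

(** * Koenig's lemma and measurability of path events *)

(** Constraints on pairs of positions, rather than on consecutive sites only,
    are what self-avoidance requires.  The proof extends a finite word while
    keeping the property of having prolongations of every length: if no
    extension by one site had it, the finitely many candidates would all fail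
    before some common length. *)
Lemma koenig_path (V : eqType) (N : V -> seq V) (r : V)
    (E : nat -> nat -> V -> V -> Prop) :
  (forall i u v, E i i.+1 u v -> v \in N u) ->
  (forall k, exists x : nat -> V,
     x 0%N = r /\ forall i j, (i < j <= k)%N -> E i j (x i) (x j)) ->
  exists x : nat -> V,
    x 0%N = r /\ forall i j, (i < j)%N -> E i j (x i) (x j).
Proof.
move=> EN Ek.
pose good m (y : nat -> V) := forall i j, (i < j <= m)%N -> E i j (y i) (y j).
pose ext k (x : nat -> V) := forall m, exists y,
  (forall i, (i <= k)%N -> y i = x i) /\ good m y.
have goodW m m' y : (m <= m')%N -> good m' y -> good m y.
  move=> mm' gy i j /andP[ij jm]; apply: gy.
  by rewrite ij (leq_trans jm).
pose upd k (x : nat -> V) v i := if (i <= k)%N then x i else v.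
have step k x : ext k x -> exists v, ext k.+1 (upd k x v).
  move=> ekx; apply: contrapT => /forallNP nE.
  have /choice[m mP] v : exists m, ~ exists y,
      (forall i, (i <= k.+1)%N -> y i = upd k x v i) /\ good m y.
    by apply/existsNP; exact: nE.
  (* Beyond length M none of the candidates after x k can be prolonged. *)
  pose M := maxn k.+1 (\max_(v <- N (x k)) m v).
  have [y [yx gy]] := ekx M.
  have yN : y k.+1 \in N (x k).
    rewrite -(yx k)//; apply: (EN k); apply: gy.
    by rewrite ltnSn leq_maxl.
  apply: (mP (y k.+1)); exists y; split; last first.
    apply: goodW gy; rewrite leq_max; apply/orP; right.
    exact: leq_bigmax_seq.
  move=> i; rewrite /upd leq_eqVlt => /predU1P[->|]; first by rewrite ltnn.
  by rewrite ltnS => ik; rewrite ik yx.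
have /choice[next nextP] (kx : nat * (nat -> V)) :
    exists v, ext kx.1 kx.2 -> ext kx.1.+1 (upd kx.1 kx.2 v).
  have [/step[v ev]|ne] := pselect (ext kx.1 kx.2); first by exists v.
  by exists r.
pose xs := fix xs k := if k is k'.+1 then upd k' (xs k') (next (k', xs k'))
                       else fun=> r.
have exs k : ext k (xs k).
  elim: k => [m|k IH]; last exact: (nextP (k, xs k)).
  have [y [y0 gy]] := Ek m; exists y; split => // i.
  by rewrite leqn0 => /eqP ->.
have xsE i j : (i <= j)%N -> xs j i = xs i i.
  elim: j => [|j IH]; first by rewrite leqn0 => /eqP ->.
  rewrite leq_eqVlt => /predU1P[->//|]; rewrite ltnS => ij.
  by rewrite /= /upd ij IH.
exists (fun k => xs k k); split => // i j ij.
have [y [yx gy]] := exs j j.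
by rewrite -(xsE i j (ltnW ij)) -!yx ?(ltnW ij)//; apply: gy; rewrite ij leqnn.
Qed.

(** The randomness enters only through consecutive sites, in [F]; the
    constraint [c] is deterministic, so at each level it merely selects which
    finite words enter the countable union. *)
Lemma measurable_infinite_path (d : measure_display) (T : measurableType d)
    (V : countType) (N : V -> seq V) (r : V)
    (c : nat -> nat -> V -> V -> Prop) (F : V -> V -> set T) :
  (forall i u v, c i i.+1 u v -> v \in N u) ->
  (forall u v, measurable (F u v)) ->
  measurable [set w | exists x : nat -> V,
    [/\ x 0%N = r, forall i j, (i < j)%N -> c i j (x i) (x j) &
        forall j, F (x j) (x j.+1) w]].
Proof.
move=> cN mF.
pose word k (s : seq V) := nth r s 0 = r /\
  forall i j, (i < j <= k)%N -> c i j (nth r s i) (nth r s j).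
pose level k := \bigcup_(s : seq V)
  (if `[< word k s >] then \bigcap_(j in [set j | (j < k)%N])
     F (nth r s j) (nth r s j.+1) else set0).
rewrite (_ : mkset _ = \bigcap_k level k).
  apply: bigcapT_measurable => k; apply: countable_bigcupT_measurable => [|s].
    exact: countableP.
  by case: ifP => // _; apply: bigcap_measurableType => j _.
apply/seteqP; split => w /=.
  move=> [x [x0 xc xF]] k _; exists (mkseq x k.+1) => //.
  have nx i : (i <= k)%N -> nth r (mkseq x k.+1) i = x i.
    by move=> ik; rewrite nth_mkseq.
  rewrite ifT; last first.
    apply/asboolP; split; first by rewrite nx.
    move=> i j /andP[ij jk]; rewrite !nx//; first exact: xc.
    exact: leq_trans (ltnW ij) jk.
  by move=> j jk; rewrite (nx j (ltnW jk)) (nx j.+1 jk).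
move=> wl.
pose E i j u v := c i j u v /\ (j = i.+1 -> F u v w).
have [||x [x0 xE]] := @koenig_path V N r E.
- by move=> i u v [/cN].
- move=> k; have [s _] := wl k I; case: ifPn => // /asboolP[s0 sc] sF.
  exists (nth r s); split => // i j ijk; split; first exact: sc.
  by move=> ji; move: ijk; rewrite ji ltnSn => ik; exact: sF.
exists x; split => // [i j ij|j]; first by have [] := xE i j ij.
by have [_] := xE j j.+1 (ltnSn j); apply.
Qed.

(** * Geometry of the lattice *)

Section Neighbours.
Context (n : nat).
Implicit Types v w : 'rV[int]_n.

(** The 3^n points at sup-distance at most 1, a finite superset of the
    neighbours that is easier to enumerate; the digits 0, 1, 2 stand for the
    increments -1, 0, 1. *)
Definition box_neighbours v : seq 'rV[int]_n :=
  [seq v + \row_i ((f i)%:Z - 1) | f : {ffun 'I_n -> 'I_3}].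

Lemma lattice_adj_box v w : lattice_adj v w -> w \in box_neighbours v.
Proof.
move=> vw; have le1 i : (`|(w - v)%R ord0 i| <= 1)%N.
  by rewrite -[leqRHS]vw /l1norm (bigD1 i)//= leq_addr.
pose f : {ffun 'I_n -> 'I_3} := [ffun i => inord `|((w - v) ord0 i + 1)%R|%N].
rewrite (_ : w = v + \row_i ((f i)%:Z - 1)).
  by apply: map_f; rewrite mem_enum.
apply/rowP => i; rewrite !mxE ffunE !mxE.
have := le1 i; rewrite !mxE; set a := w _ _; set b := v _ _ => ab.
by rewrite inordK; lia.
Qed.

End Neighbours.

Section CoordinatePlane.
Context (n : nat) (i0 i1 : 'I_n).
Implicit Types a b : nat * nat.

Definition plane a : 'rV[int]_n :=
  \row_i ((i == i0) * a.1 + (i == i1) * a.2)%N%:Z.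

Let sum_indicator (k : 'I_n) : (\sum_(i < n) (i == k) = 1)%N.
Proof.
rewrite (bigD1 k)//= eqxx big1 ?addn0// => i.
by move=> /negbTE ->.
Qed.

Definition plane_inv (v : 'rV[int]_n) : nat * nat :=
  (`|v ord0 i0|%N, `|v ord0 i1|%N).

Lemma planeK : i0 != i1 -> cancel plane plane_inv.
Proof.
move=> i01 [x y]; rewrite /plane_inv /plane !mxE !eqxx.
by rewrite (eq_sym i1) (negbTE i01)/= !mul0n !mul1n addn0.
Qed.

Lemma l1norm_plane a : l1norm (plane a) = (a.1 + a.2)%N.
Proof.
rewrite /l1norm (eq_bigr (fun i => (i == i0) * a.1 + (i == i1) * a.2)%N).
  by rewrite big_split/= -!big_distrl/= !sum_indicator !mul1n.
by move=> i _; rewrite mxE.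
Qed.

Lemma plane_adj a b : oriented_edge a b -> lattice_adj (plane a) (plane b).
Proof.
case: a => x y ab; rewrite /lattice_adj.
have [e [-> e1]] : exists e, b = (x + e.1, y + e.2)%N /\ (e.1 + e.2 = 1)%N.
  by case: ab => ->; [exists (1, 0)%N | exists (0, 1)%N];
     rewrite /= ?addn0 ?addn1.
rewrite (_ : _ - _ = plane e) ?l1norm_plane//.
by apply/rowP => i; rewrite !mxE/= !mulnDr; lia.
Qed.

Lemma plane0 : plane (0, 0)%N = 0.
Proof. by apply/rowP => i; rewrite !mxE !muln0. Qed.

(** A directed path gains exactly one unit of l1 norm per step, which makes it
    self-avoiding and fixes the drift of its labels. *)
Lemma oriented_sum (x : nat -> nat * nat) :
  x 0%N = (0, 0)%N -> (forall j, oriented_edge (x j) (x j.+1)) ->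
  forall j, ((x j).1 + (x j).2)%N = j.
Proof.
move=> x0 xE; elim=> [|j IH]; first by rewrite x0.
by case: (xE j) => ->/=; rewrite ?addSn ?addnS IH.
Qed.

Lemma plane_non_backtracking (x : nat -> nat * nat) :
  x 0%N = (0, 0)%N -> (forall j, oriented_edge (x j) (x j.+1)) ->
  non_backtracking_path (plane \o x).
Proof.
move=> x0 xE; have nE j : l1norm (plane (x j)) = j.
  by rewrite l1norm_plane oriented_sum.
split; last by move=> j /=; rewrite !nE.
split=> [j|j k /= /(congr1 (@l1norm n))]; first exact: plane_adj.
by rewrite !nE.
Qed.

End CoordinatePlane.

(** * Independent open sites from uniform labels *)

(** The left inverse [g] of the reindexing turns the test sets for [Y] into a
    family of test sets indexed by all of [K], as independence of [X]
    demands. *)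
Lemma mutually_independent_comp (d d1 d2 : measure_display)
    (T : measurableType d) (T1 : measurableType d1) (T2 : measurableType d2)
    (R : realType) (P : probability T R) (I K : choiceType)
    (X : K -> {RV P >-> T1}) (Y : I -> {RV P >-> T2}) (phi : T1 -> T2)
    (h : I -> K) (g : K -> I) :
  cancel h g -> measurable_fun setT phi ->
  (forall i w, Y i w = phi (X (h i) w)) ->
  mutually_independent X -> mutually_independent Y.
Proof.
move=> hK mphi YE indX J B mB.
pose C k := phi @^-1` B (g k).
have CE i : Y i @^-1` B i = X (h i) @^-1` C (h i).
  by apply/seteqP; split => w; rewrite /C /= hK YE.
have mC k : measurable (C k) by rewrite -[C k]setTI; exact: mphi.
have := indX (h @` J)%fset C mC.
rewrite big_imfset /=; last by move=> i j _ _; exact: (can_inj hK).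
move=> indC; rewrite (eq_bigr (fun i => P (X (h i) @^-1` C (h i)))); last first.
  by move=> i _; rewrite CE.
rewrite -indC; congr (P _); apply/seteqP; split => w wB.
  move=> k /imfsetP[i iJ ->]; have := wB i iJ.
  by rewrite CE.
move=> i iJ; rewrite CE; apply: (wB (h i)).
by apply/imfsetP; exists i.
Qed.

Lemma uniform01_co (R : realType) (theta : R) : 0 <= theta <= 1 ->
  uniform_prob (ltr01 : (0 : R) < 1) `[0, theta[ = theta%:E.
Proof.
move=> /andP[t0 t1]; rewrite /uniform_prob.
rewrite (eq_integral (cst 1%E)); last first.
  move=> x; rewrite inE/= in_itv/= => /andP[x0 xt].
  by rewrite /uniform_pdf x0 (ltW (lt_le_trans xt t1))/= subr0 invr1.
rewrite integral_cst//= mul1e lebesgue_measure_itv/= lte_fin.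
by case: ltgtP t0 => // [_|<-] _; rewrite ?oppr0 ?adde0// sube0.
Qed.

Section LowSites.
Context (d : measure_display) (T : measurableType d) (R : realType).
Context (P : probability T R) (n : nat).
Implicit Types (U : 'rV[int]_n -> {RV P >-> R}) (theta : R).

(** The lower bound 0 holds almost surely, but testing it makes the comparison
    of percolation events hold at every sample point. *)
Definition low_site theta U v (w : T) : bool := U v w \in `[0, theta[.

Lemma measurable_co_test theta :
  measurable_fun setT (fun u : R => u \in `[0, theta[).
Proof.
apply: (measurable_fun_bool true); rewrite setTI.
rewrite (_ : _ @^-1` _ = `[0, theta[%classic); first exact: measurable_itv.
by apply/seteqP; split.
Qed.

Lemma measurable_low_site theta U v : measurable_fun setT (low_site theta U v).
Proof. exact: (measurableT_comp (measurable_co_test theta)). Qed.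

HB.instance Definition _ theta U v :=
  isMeasurableFun.Build _ _ _ _ (low_site theta U v)
    (measurable_low_site theta U v).

Lemma iid_low_sites theta U (i0 i1 : 'I_n) : i0 != i1 -> 0 <= theta <= 1 ->
  iid_uniform01 U ->
  iid_open_sites
    (fun a => low_site theta U (plane i0 i1 a) : {RV P >-> bool}) theta.
Proof.
move=> i01 t01 [indU lawU]; split.
  exact: (mutually_independent_comp (planeK i01) (measurable_co_test theta)
    _ indU).
move=> a; rewrite -(uniform01_co t01) -(lawU (plane i0 i1 a)).
  by congr (P _); apply/seteqP; split.
exact: measurable_itv.
Qed.

End LowSites.

(** * Percolation events *)

Section PercolationEvents.
Context (d : measure_display) (T : measurableType d) (R : realType).
Context (P : probability T R) (n : nat).
Implicit Types (U : 'rV[int]_n -> {RV P >-> R}) (theta : R).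

Lemma measurable_rmf_percolation permitted
    (c : nat -> nat -> 'rV[int]_n -> 'rV[int]_n -> Prop) U theta :
  (forall i u v, c i i.+1 u v -> lattice_adj u v) ->
  (forall x, permitted x <-> forall i j, (i < j)%N -> c i j (x i) (x j)) ->
  measurable (rmf_percolation permitted U theta).
Proof.
move=> cadj permE.
have mlabel v : measurable_fun setT (rmf_label U theta v).
  exact: measurable_funD.
rewrite (_ : rmf_percolation _ _ _ = [set w | exists x : nat -> 'rV[int]_n,
    [/\ x 0%N = 0, forall i j, (i < j)%N -> c i j (x i) (x j) & forall j,
        [set w | rmf_label U theta (x j) w < rmf_label U theta (x j.+1) w] w]]).
  apply: (@measurable_infinite_path _ _ _ (@box_neighbours n) 0 c
    (fun u v => [set w | rmf_label U theta u w < rmf_label U theta v w])).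
    by move=> i u v /cadj; exact: lattice_adj_box.
  move=> u v; rewrite -[X in measurable X]setTI.
  have := measurable_fun_ltr (mlabel u) (mlabel v).
  by move=> /(_ measurableT [set true] I).
by apply/seteqP; split=> w [x [x0 xp xl]]; exists x; split => //; apply/permE.
Qed.

(** Self-avoidance and adjacency, as a condition on two sites visited at times
    [i < j]. *)
Definition simple_pair i j (u v : 'rV[int]_n) : Prop :=
  u != v /\ (j = i.+1 -> lattice_adj u v).

Lemma simple_pathE x :
  simple_path x <-> forall i j, (i < j)%N -> simple_pair i j (x i) (x j).
Proof.
split=> [[xadj xinj] i j ij|xc].
  split=> [|->//]; apply/eqP => /xinj ijE; by rewrite ijE ltnn in ij.
split=> [j|i j xij]; first by have [_] := xc j j.+1 (ltnSn j); apply.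
by case: (ltngtP i j) => // /xc[]; rewrite xij eqxx.
Qed.

Lemma measurable_rmf_simple U theta :
  measurable (rmf_percolation (@simple_path n) U theta).
Proof.
apply: (@measurable_rmf_percolation _ simple_pair); last exact: simple_pathE.
by move=> i u v [_]; apply.
Qed.

Lemma measurable_rmf_non_backtracking U theta :
  measurable (rmf_percolation (@non_backtracking_path n) U theta).
Proof.
apply: (@measurable_rmf_percolation _ (fun i j u v =>
  simple_pair i j u v /\ (j = i.+1 -> (l1norm u < l1norm v)%N))).
  by move=> i u v [[_]]; move=> /(_ erefl).
move=> x; split=> [[/simple_pathE xs xn] i j ij|xc].
  by split=> [|->//]; exact: xs.
split; first by apply/simple_pathE => i j /xc[].
by move=> j; have [_] := xc j j.+1 (ltnSn j); apply.
Qed.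

(** The hypothesis [0 <= pc] covers the default value 0 of the supremum of an
    empty set. *)
Lemma rmf_critical_le permitted U (pc : R) : 0 <= pc ->
  (forall theta, 0 <= theta <= 1 -> pc < theta ->
     (0 < P (rmf_percolation permitted U theta))%E) ->
  rmf_critical permitted U <= pc.
Proof.
move=> pc0 pos; rewrite /rmf_critical; set S := [set _ | _].
have [->|/set0P S0] := eqVneq S set0; first by rewrite sup0.
apply: ge_sup => // theta [t01 Pt0]; rewrite leNgt; apply/negP => /pos.
by move=> /(_ t01); rewrite Pt0 ltxx.
Qed.

Lemma measurable_oriented_percolation (sigma : nat * nat -> {RV P >-> bool}) :
  measurable (oriented_percolation sigma).
Proof.
pose c (i j : nat) a b := j = i.+1 -> oriented_edge a b.
rewrite (_ : oriented_percolation _ = [set w | exists x : nat -> nat * nat,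
    [/\ x 0%N = (0, 0)%N, forall i j, (i < j)%N -> c i j (x i) (x j) & forall j,
        (sigma (x j) @^-1` [set true]) w]]).
  apply: (@measurable_infinite_path _ _ _
    (fun a => [:: (a.1.+1, a.2); (a.1, a.2.+1)]) _ c
    (fun a _ => sigma a @^-1` [set true])).
    by move=> i a b /(_ erefl) [] ->; rewrite !inE eqxx ?orbT.
  by move=> a _; rewrite -[X in measurable X]setTI; exact: measurable_funP.
apply/seteqP; split=> w [x [x0 xc xs]]; exists x; split => //.
  by move=> i j _ ->.
by move=> j; exact: (xc j j.+1 (ltnSn j)).
Qed.

(** If [U v < theta] and [0 <= U w] with [w] one step further out, then
    [X v < theta * |v| + theta <= X w]. *)
Lemma oriented_sub_rmf theta U (i0 i1 : 'I_n) : i0 != i1 ->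
  oriented_percolation
    (fun a => low_site theta U (plane i0 i1 a) : {RV P >-> bool}) `<=`
  rmf_percolation (@non_backtracking_path n) U theta.
Proof.
move=> i01 w [x [x0 xE xs]]; exists (plane i0 i1 \o x); split.
- by rewrite /= x0 plane0.
- exact: plane_non_backtracking.
move=> j; rewrite /rmf_label /= !l1norm_plane// !oriented_sum//.
have /andP[_ lt_theta] : 0 <= U (plane i0 i1 (x j)) w < theta := xs j.
have /andP[ge0 _] : 0 <= U (plane i0 i1 (x j.+1)) w < theta := xs j.+1.
rewrite -natr1 mulrDr mulr1.
lra.
Qed.

End PercolationEvents.

Theorem proposition1p14 (R : realType) (n : nat) (hn : (2 <= n)%N)
  (pc : R) (hpc : is_oriented_critical pc) (hpc1 : pc < 1)
  (d : measure_display) (T : measurableType d) (P : probability T R)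
  (U : 'rV[int]_n -> {RV P >-> R}) (hU : iid_uniform01 U) :
  ((forall theta : R, 0 <= theta <= 1 -> pc < theta ->
      (0 < P (rmf_percolation (@non_backtracking_path n) U theta))%E) /\
   rmf_critical (@non_backtracking_path n) U <= pc) /\
  ((forall theta : R, 0 <= theta <= 1 -> pc < theta ->
      (0 < P (rmf_percolation (@simple_path n) U theta))%E) /\
   rmf_critical (@simple_path n) U <= pc).
Proof.
have [/andP[pc0 _] crit] := hpc.
have nb theta : 0 <= theta <= 1 -> pc < theta ->
    (0 < P (rmf_percolation (@non_backtracking_path n) U theta))%E.
  move=> t01 pct.
  pose i0 := Ordinal (ltnW hn); pose i1 := Ordinal hn.
  have i01 : i0 != i1 by [].
  have [/(_ pct) + _] := crit _ t01 _ _ _ _ (iid_low_sites i01 t01 hU).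
  move=> /lt_le_trans; apply; apply: le_measure; rewrite ?inE.
  - exact: measurable_oriented_percolation.
  - exact: measurable_rmf_non_backtracking.
  exact: oriented_sub_rmf.
have simple theta : 0 <= theta <= 1 -> pc < theta ->
    (0 < P (rmf_percolation (@simple_path n) U theta))%E.
  move=> t01 /(nb _ t01)/lt_le_trans; apply; apply: le_measure; rewrite ?inE.
  - exact: measurable_rmf_non_backtracking.
  - exact: measurable_rmf_simple.
  by move=> w [x [x0 [xs _] xl]]; exists x.
by split; split => //; exact: rmf_critical_le.
Qed.
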